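(* Let $\mathsf{C}$ be a cartesian monoidal category and let $P$ be an affine bimonoidal monad on $\mathsf{C}$, with lax multiplication $\nabla$ and oplax comultiplication $\Delta$. Consider a law $s:1\to PA$ and maps $f_1:A\to B_1$ and $f_2:A\to B_2$ in $\mathsf{C}$. Then $f_1$ and $f_2$ are independent in the sense of Franz (with respect to $s$) if and only if $B_1$ and $B_2$ are independent for the law $P(f_1,f_2)\circ s:1\to P(B_1\times B_2)$, i.e. if and only if $$\nabla_{B_1,B_2}\circ\Delta_{B_1,B_2}\circ P(f_1,f_2)\circ s=P(f_1,f_2)\circ s.$$
   Context: $\mathsf{C}$ is a category with finite products with its cartesian (symmetric) monoidal structure; $1$ is the terminal object, and $(f_1,f_2):A\to B_1\times B_2$ is the pairing. $P$ affine means $P(1)\cong 1$. The category $\mathsf{Prob}(\mathsf{C})$ has as objects pairs $(X,p)$ with $X\in\mathsf{C}$ and $p:1\to PX$ a morphism of $\mathsf{C}$ (a law), and as morphisms $(X,p)\to(Y,q)$ the maps $f:X\to Y$ of $\mathsf{C}$ with $Pf\circ p=q$. It carries the semicartesian monoidal structure $(X,p)\otimes(Y,q)=(X\times Y,\ p\otimes_\nabla q)$, where $p\otimes_\nabla q$ is the composite $1\cong 1\times 1\xrightarrow{p\times q}PX\times PY\xrightarrow{\nabla}P(X\times Y)$. Its projections onto the tensor factors are the product projections $\pi_1,\pi_2$ of $\mathsf{C}$. Independence in the sense of Franz: in a semicartesian monoidal category, morphisms $f_1:A\to B_1$ and $f_2:A\to B_2$ are independent iff there is a morphism $h:A\to B_1\otimes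 B_2$ with $\pi_1\circ h=f_1$ and $\pi_2\circ h=f_2$, where $\pi_i$ are the projections of the tensor product. For the maps $f_1,f_2$ and law $s$ of the statement, this is applied in $\mathsf{Prob}(\mathsf{C})$ to the morphisms $f_i:(A,s)\to(B_i,r_i)$ with $r_i:=Pf_i\circ s$. That is, there exists $h:A\to B_1\times B_2$ in $\mathsf{C}$ with $\pi_i\circ h=f_i$ ($i=1,2$) and $Ph\circ s=r_1\otimes_\nabla r_2$. A bimonoidal monad is a monad $(P,\delta,E)$ with a lax monoidal structure $(\eta:1\to P(1),\nabla_{X,Y}:PX\otimes PY\to P(X\otimes Y))$ and an oplax monoidal structure $(\epsilon:P(1)\to 1,\Delta_{X,Y}:P(X\otimes Y)\to PX\otimes PY)$ on $P$ such that: (i) for all $W,X,Y,Z$, $$\Delta_{W\otimes Y,X\otimes Z}\circ P(\mathrm{id}_W\otimes \beta_{X,Y}\otimes \mathrm{id}_Z)\circ\nabla_{W\otimes X,Y\otimes Z}=(\nabla_{W,Y}\otimes\nabla_{X,Z})\circ(\mathrm{id}\otimes\beta_{PX,PY}\otimes\mathrm{id})\circ(\Delta_{W,X}\otimes\Delta_{Y,Z}),$$ where $\beta$ is the braiding and associators are suppressed; (ii) $\epsilon\circ\eta=\mathrm{id}_1$; the composite $1\xrightarrow{\eta}P(1)\cong P(1\otimes 1)\xrightarrow{\Delta_{1,1}}P(1)\otimes P(1)$ equals $1\cong 1\otimes 1\xrightarrow{\eta\otimes\eta}P(1)\otimes P(1)$; and $P(1)\otimes P(1)\xrightarrow{\nabla_{1,1}}P(1\otimes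 1)\cong P(1)\xrightarrow{\epsilon}1$ equals $P(1)\otimes P(1)\xrightarrow{\epsilon\otimes\epsilon}1\otimes 1\cong 1$; (iii) $\delta:\mathrm{id}\Rightarrow P$ and $E:PP\Rightarrow P$ are both lax and oplax monoidal natural transformations ($PP$ carrying the composite structures). *)

(* Defs.v *)
From Stdlib Require Import ProofIrrelevance.

Set Implicit Arguments.
Unset Strict Implicit.
Unset Printing Implicit Defensive.

#[local] Obligation Tactic := idtac.

Declare Scope cat_scope.
Delimit Scope cat_scope with cat.
Local Open Scope cat_scope.

Record Category := {
  obj :> Type;
  hom : obj -> obj -> Type;
  idm : forall X, hom X X;
  comp : forall X Y Z, hom Y Z -> hom X Y -> hom X Z;
  comp_idl : forall X Y (f : hom X Y), comp (idm Y) f = f;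
  comp_idr : forall X Y (f : hom X Y), comp f (idm X) = f;
  comp_assoc : forall W X Y Z (h : hom Y Z) (g : hom X Y) (f : hom W X),
    comp (comp h g) f = comp h (comp g f)
}.
Arguments hom {c} X Y.
Arguments idm {c} X.
Arguments comp {c X Y Z} g f.
Notation "g ∘ f" := (comp g f) (at level 40, left associativity) : cat_scope.
Notation "X ~> Y" := (hom X Y) (at level 90, right associativity) : cat_scope.

Definition isomorphic (C : Category) (X Y : C) : Prop :=
  exists (f : X ~> Y) (g : Y ~> X), g ∘ f = idm X /\ f ∘ g = idm Y.

Record Functor (C D : Category) := {
  fobj :> C -> D;
  fmap : forall X Y : C, (X ~> Y) -> (fobj X ~> fobj Y);
  fmap_id : forall X : C, fmap (idm X) = idm (fobj X);
  fmap_comp : forall (X Y Z : C) (g : Y ~> Z) (f : X ~> Y),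
    fmap (g ∘ f) = fmap g ∘ fmap f
}.
Arguments fmap {C D} F {X Y} f : rename.

Program Definition id_functor (C : Category) : Functor C C :=
  {| fobj := fun X => X; fmap := fun X Y f => f |}.
Next Obligation. reflexivity. Qed.
Next Obligation. reflexivity. Qed.

Program Definition comp_functor (C D E : Category)
    (G : Functor D E) (F : Functor C D) : Functor C E :=
  {| fobj := fun X => G (F X); fmap := fun X Y f => fmap G (fmap F f) |}.
Next Obligation. intros; simpl; now rewrite !fmap_id. Qed.
Next Obligation. intros; simpl; now rewrite !fmap_comp. Qed.

Record NatTrans (C D : Category) (F G : Functor C D) := {
  component :> forall X : C, F X ~> G X;
  natural : forall (X Y : C) (f : X ~> Y),
    component Y ∘ fmap F f = fmap G f ∘ component X
}.

Record Monad (C : Category) := {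
  mfun :> Functor C C;
  munit : NatTrans (id_functor C) mfun;
  mmult : NatTrans (comp_functor mfun mfun) mfun;
  mmult_unit_l : forall X : C, mmult X ∘ munit (mfun X) = idm (mfun X);
  mmult_unit_r : forall X : C, mmult X ∘ fmap mfun (munit X) = idm (mfun X);
  mmult_assoc : forall X : C,
    mmult X ∘ mmult (mfun X) = mmult X ∘ fmap mfun (mmult X)
}.
Arguments munit {C} P : rename.
Arguments mmult {C} P : rename.

Record Monoidal (C : Category) := {
  tunit : C;
  tens : C -> C -> C;
  thom : forall X Y X' Y' : C,
    (X ~> X') -> (Y ~> Y') -> (tens X Y ~> tens X' Y');
  alpha : forall X Y Z : C, tens (tens X Y) Z ~> tens X (tens Y Z);
  alpha_inv : forall X Y Z : C, tens X (tens Y Z) ~> tens (tens X Y) Z;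
  lam : forall X : C, tens tunit X ~> X;
  lam_inv : forall X : C, X ~> tens tunit X;
  rho : forall X : C, tens X tunit ~> X;
  rho_inv : forall X : C, X ~> tens X tunit;
  thom_id : forall X Y : C, thom (idm X) (idm Y) = idm (tens X Y);
  thom_comp : forall (X Y X' Y' X'' Y'' : C)
      (f' : X' ~> X'') (g' : Y' ~> Y'') (f : X ~> X') (g : Y ~> Y'),
    thom (f' ∘ f) (g' ∘ g) = thom f' g' ∘ thom f g;
  alpha_nat : forall (X Y Z X' Y' Z' : C)
      (f : X ~> X') (g : Y ~> Y') (h : Z ~> Z'),
    alpha X' Y' Z' ∘ thom (thom f g) h = thom f (thom g h) ∘ alpha X Y Z;
  lam_nat : forall (X X' : C) (f : X ~> X'),
    lam X' ∘ thom (idm tunit) f = f ∘ lam X;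
  rho_nat : forall (X X' : C) (f : X ~> X'),
    rho X' ∘ thom f (idm tunit) = f ∘ rho X;
  alphaK : forall X Y Z : C, alpha_inv X Y Z ∘ alpha X Y Z = idm _;
  alpha_invK : forall X Y Z : C, alpha X Y Z ∘ alpha_inv X Y Z = idm _;
  lamK : forall X : C, lam_inv X ∘ lam X = idm _;
  lam_invK : forall X : C, lam X ∘ lam_inv X = idm _;
  rhoK : forall X : C, rho_inv X ∘ rho X = idm _;
  rho_invK : forall X : C, rho X ∘ rho_inv X = idm _;
  pentagon : forall W X Y Z : C,
    thom (idm W) (alpha X Y Z) ∘ alpha W (tens X Y) Z ∘ thom (alpha W X Y) (idm Z)
    = alpha W X (tens Y Z) ∘ alpha (tens W X) Y Z;
  triangle : forall X Y : C,
    thom (idm X) (lam Y) ∘ alpha X tunit Y = thom (rho X) (idm Y)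
}.
Arguments tunit {C} M : rename.
Arguments tens {C} M X Y : rename.
Arguments thom {C} M {X Y X' Y'} f g : rename.
Arguments alpha {C} M X Y Z : rename.
Arguments alpha_inv {C} M X Y Z : rename.
Arguments lam {C} M X : rename.
Arguments lam_inv {C} M X : rename.
Arguments rho {C} M X : rename.
Arguments rho_inv {C} M X : rename.

Record Symmetric (C : Category) := {
  sym_monoidal :> Monoidal C;
  braid : forall X Y : C, tens sym_monoidal X Y ~> tens sym_monoidal Y X;
  braid_nat : forall (X Y X' Y' : C) (f : X ~> X') (g : Y ~> Y'),
    braid X' Y' ∘ thom sym_monoidal f g = thom sym_monoidal g f ∘ braid X Y;
  braid_sym : forall X Y : C, braid Y X ∘ braid X Y = idm _;
  hexagon : forall X Y Z : C,
    alpha sym_monoidal Y Z X ∘ braid X (tens sym_monoidal Y Z)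
      ∘ alpha sym_monoidal X Y Z
    = thom sym_monoidal (idm Y) (braid X Z) ∘ alpha sym_monoidal Y X Z
      ∘ thom sym_monoidal (braid X Y) (idm Z)
}.
Arguments braid {C} S X Y : rename.

(** [id ⊗ β ⊗ id], with the associators made explicit. *)
Definition interchange (C : Category) (S : Symmetric C) (W X Y Z : C) :
    tens S (tens S W X) (tens S Y Z) ~> tens S (tens S W Y) (tens S X Z) :=
  alpha_inv S W Y (tens S X Z)
  ∘ thom S (idm W)
      (alpha S Y X Z ∘ thom S (braid S X Y) (idm Z) ∘ alpha_inv S X Y Z)
  ∘ alpha S W X (tens S Y Z).

Record Semicartesian (C : Category) := {
  semi_monoidal :> Monoidal C;
  discard : forall X : C, X ~> tunit semi_monoidal;
  discard_uniq : forall (X : C) (f g : X ~> tunit semi_monoidal), f = g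
}.
Arguments discard {C} S X : rename.

(** Projections of a tensor in a semicartesian category: discard one factor, then
    apply the unitor. *)
Definition tproj1 (C : Category) (S : Semicartesian C) (X Y : C) :
    tens S X Y ~> X :=
  rho S X ∘ thom S (idm X) (discard S Y).

Definition tproj2 (C : Category) (S : Semicartesian C) (X Y : C) :
    tens S X Y ~> Y :=
  lam S Y ∘ thom S (discard S X) (idm Y).

Definition franz_independent (C : Category) (S : Semicartesian C)
    (A B1 B2 : C) (f1 : A ~> B1) (f2 : A ~> B2) : Prop :=
  exists h : A ~> tens S B1 B2,
    tproj1 S B1 B2 ∘ h = f1 /\ tproj2 S B1 B2 ∘ h = f2.

(** No compatibility with a braiding is imposed on lax or oplax structures. *)
Record Lax (C : Category) (M : Monoidal C) (F : Functor C C) := {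
  eta : tunit M ~> F (tunit M);
  nabla : forall X Y : C, tens M (F X) (F Y) ~> F (tens M X Y);
  nabla_nat : forall (X Y X' Y' : C) (f : X ~> X') (g : Y ~> Y'),
    nabla X' Y' ∘ thom M (fmap F f) (fmap F g) = fmap F (thom M f g) ∘ nabla X Y;
  nabla_assoc : forall X Y Z : C,
    fmap F (alpha M X Y Z) ∘ nabla (tens M X Y) Z ∘ thom M (nabla X Y) (idm (F Z))
    = nabla X (tens M Y Z) ∘ thom M (idm (F X)) (nabla Y Z)
      ∘ alpha M (F X) (F Y) (F Z);
  nabla_unit_l : forall X : C,
    fmap F (lam M X) ∘ nabla (tunit M) X ∘ thom M eta (idm (F X)) = lam M (F X);
  nabla_unit_r : forall X : C,
    fmap F (rho M X) ∘ nabla X (tunit M) ∘ thom M (idm (F X)) eta = rho M (F X)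
}.
Arguments eta {C M F} L : rename.
Arguments nabla {C M F} L X Y : rename.

Record Oplax (C : Category) (M : Monoidal C) (F : Functor C C) := {
  epsilon : F (tunit M) ~> tunit M;
  Delta : forall X Y : C, F (tens M X Y) ~> tens M (F X) (F Y);
  Delta_nat : forall (X Y X' Y' : C) (f : X ~> X') (g : Y ~> Y'),
    Delta X' Y' ∘ fmap F (thom M f g) = thom M (fmap F f) (fmap F g) ∘ Delta X Y;
  Delta_assoc : forall X Y Z : C,
    thom M (idm (F X)) (Delta Y Z) ∘ Delta X (tens M Y Z) ∘ fmap F (alpha M X Y Z)
    = alpha M (F X) (F Y) (F Z) ∘ thom M (Delta X Y) (idm (F Z))
      ∘ Delta (tens M X Y) Z;
  Delta_unit_l : forall X : C,
    lam M (F X) ∘ thom M epsilon (idm (F X)) ∘ Delta (tunit M) X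
    = fmap F (lam M X);
  Delta_unit_r : forall X : C,
    rho M (F X) ∘ thom M (idm (F X)) epsilon ∘ Delta X (tunit M)
    = fmap F (rho M X)
}.
Arguments epsilon {C M F} O : rename.
Arguments Delta {C M F} O X Y : rename.

Record lax_transformation (C : Category) (M : Monoidal C) (F G : Functor C C)
    (LF : Lax M F) (LG : Lax M G) (t : NatTrans F G) : Prop := {
  lax_trans_unit : t (tunit M) ∘ eta LF = eta LG;
  lax_trans_mult : forall X Y : C,
    t (tens M X Y) ∘ nabla LF X Y = nabla LG X Y ∘ thom M (t X) (t Y)
}.

Record oplax_transformation (C : Category) (M : Monoidal C) (F G : Functor C C)
    (OF : Oplax M F) (OG : Oplax M G) (t : NatTrans F G) : Prop := {
  oplax_trans_unit : epsilon OG ∘ t (tunit M) = epsilon OF;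
  oplax_trans_mult : forall X Y : C,
    Delta OG X Y ∘ t (tens M X Y) = thom M (t X) (t Y) ∘ Delta OF X Y
}.

Section LaxConstructions.
Variables (C : Category) (M : Monoidal C).

Lemma comp_congl (X Y Z : C) (g g' : Y ~> Z) (f : X ~> Y) :
  g = g' -> g ∘ f = g' ∘ f.
Proof. now intros ->. Qed.

Lemma thom_splitl (X X' X'' Y Y' : C) (f' : X' ~> X'') (f : X ~> X') (g : Y ~> Y') :
  thom M (f' ∘ f) g = thom M f' (idm Y') ∘ thom M f g.
Proof. now rewrite <- thom_comp, comp_idl. Qed.

Lemma thom_splitr (X X' Y Y' Y'' : C) (f : X ~> X') (g' : Y' ~> Y'') (g : Y ~> Y') :
  thom M f (g' ∘ g) = thom M (idm X') g' ∘ thom M f g.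
Proof. now rewrite <- thom_comp, comp_idl. Qed.

Program Definition id_lax : Lax M (id_functor C) :=
  {| eta := idm (tunit M); nabla := fun X Y => idm (tens M X Y) |}.
Next Obligation. intros; simpl; now rewrite comp_idl, comp_idr. Qed.
Next Obligation. intros; simpl; now rewrite !thom_id, ?comp_idl, !comp_idr. Qed.
Next Obligation. intros; simpl; now rewrite thom_id, !comp_idr. Qed.
Next Obligation. intros; simpl; now rewrite thom_id, !comp_idr. Qed.

Program Definition id_oplax : Oplax M (id_functor C) :=
  {| epsilon := idm (tunit M); Delta := fun X Y => idm (tens M X Y) |}.
Next Obligation. intros; simpl; now rewrite comp_idl, comp_idr. Qed.
Next Obligation. intros; simpl; now rewrite !thom_id, ?comp_idl, !comp_idr. Qed.
Next Obligation. intros; simpl; now rewrite thom_id, !comp_idr. Qed.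
Next Obligation. intros; simpl; now rewrite thom_id, !comp_idr. Qed.

Variables (F G : Functor C C).

Program Definition comp_lax (LG : Lax M G) (LF : Lax M F) :
    Lax M (comp_functor G F) :=
  {| eta := fmap G (eta LF) ∘ eta LG;
     nabla := fun X Y => fmap G (nabla LF X Y) ∘ nabla LG (F X) (F Y) |}.
Next Obligation.
  intros; simpl.
  now rewrite comp_assoc, nabla_nat, <- !comp_assoc, <- !fmap_comp, nabla_nat.
Qed.
Next Obligation.
  intros LG LF X Y Z; simpl.
  rewrite thom_splitl, thom_splitr.
  rewrite <- (fmap_id G (F Z)), <- (fmap_id G (F X)).
  rewrite <- !comp_assoc.
  rewrite !(comp_assoc _ (nabla LG _ _) (thom M (fmap G _) (fmap G _))), !nabla_nat.
  rewrite <- !comp_assoc, <- !fmap_comp, nabla_assoc, !fmap_comp, !fmap_id.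
  rewrite !comp_assoc; do 2 f_equal.
  rewrite <- !comp_assoc; apply nabla_assoc.
Qed.
Next Obligation.
  intros LG LF X; simpl.
  rewrite thom_splitl, <- (fmap_id G (F X)), <- !comp_assoc.
  rewrite !(comp_assoc _ (nabla LG _ _) (thom M (fmap G _) (fmap G _))), !nabla_nat.
  rewrite <- !comp_assoc, <- !fmap_comp, nabla_unit_l, fmap_id.
  apply nabla_unit_l.
Qed.
Next Obligation.
  intros LG LF X; simpl.
  rewrite thom_splitr, <- (fmap_id G (F X)), <- !comp_assoc.
  rewrite !(comp_assoc _ (nabla LG _ _) (thom M (fmap G _) (fmap G _))), !nabla_nat.
  rewrite <- !comp_assoc, <- !fmap_comp, nabla_unit_r, fmap_id.
  apply nabla_unit_r.
Qed.

Lemma thom_splitl' (X X' X'' Y Y' : C) (f' : X' ~> X'') (f : X ~> X') (g : Y ~> Y') :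
  thom M (f' ∘ f) g = thom M f' g ∘ thom M f (idm Y).
Proof. now rewrite <- thom_comp, comp_idr. Qed.

Lemma thom_splitr' (X X' Y Y' Y'' : C) (f : X ~> X') (g' : Y' ~> Y'') (g : Y ~> Y') :
  thom M f (g' ∘ g) = thom M f g' ∘ thom M (idm X) g.
Proof. now rewrite <- thom_comp, comp_idr. Qed.

Program Definition comp_oplax (OG : Oplax M G) (OF : Oplax M F) :
    Oplax M (comp_functor G F) :=
  {| epsilon := epsilon OG ∘ fmap G (epsilon OF);
     Delta := fun X Y => Delta OG (F X) (F Y) ∘ fmap G (Delta OF X Y) |}.
Next Obligation.
  intros; simpl.
  now rewrite comp_assoc, <- fmap_comp, Delta_nat, fmap_comp, <- !comp_assoc, Delta_nat.
Qed.
Next Obligation.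
  intros OG OF X Y Z; simpl.
  rewrite thom_splitl', thom_splitr'.
  rewrite <- (fmap_id G (F Z)), <- (fmap_id G (F X)).
  rewrite !comp_assoc.
  rewrite <- !(comp_assoc (thom M (fmap G _) (fmap G _)) (Delta OG _ _)).
  rewrite <- !Delta_nat.
  rewrite !comp_assoc, <- !fmap_comp, <- comp_assoc.
  rewrite <- comp_assoc, Delta_assoc, !fmap_comp, !fmap_id.
  rewrite <- !comp_assoc; do 2 apply comp_congl.
  apply Delta_assoc.
Qed.
Next Obligation.
  intros OG OF X; simpl.
  rewrite thom_splitl', <- (fmap_id G (F X)), !comp_assoc.
  rewrite <- !(comp_assoc (thom M (fmap G _) (fmap G _)) (Delta OG _ _)), <- !Delta_nat.
  now rewrite <- !comp_assoc, (fmap_id G (F X)), Delta_unit_l, <- !fmap_comp, Delta_unit_l.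
Qed.
Next Obligation.
  intros OG OF X; simpl.
  rewrite thom_splitr', <- (fmap_id G (F X)), !comp_assoc.
  rewrite <- !(comp_assoc (thom M (fmap G _) (fmap G _)) (Delta OG _ _)), <- !Delta_nat.
  now rewrite <- !comp_assoc, (fmap_id G (F X)), Delta_unit_r, <- !fmap_comp, Delta_unit_r.
Qed.

End LaxConstructions.

Record BimonoidalMonad (C : Category) (S : Symmetric C) := {
  bmonad :> Monad C;
  blax : Lax S bmonad;
  boplax : Oplax S bmonad;
  bim_mult : forall W X Y Z : C,
    Delta boplax (tens S W Y) (tens S X Z)
      ∘ fmap bmonad (interchange S W X Y Z)
      ∘ nabla blax (tens S W X) (tens S Y Z)
    = thom S (nabla blax W Y) (nabla blax X Z)
      ∘ interchange S (bmonad W) (bmonad X) (bmonad Y) (bmonad Z)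
      ∘ thom S (Delta boplax W X) (Delta boplax Y Z);
  bim_unit_counit : epsilon boplax ∘ eta blax = idm (tunit S);
  bim_unit_comult :
    Delta boplax (tunit S) (tunit S) ∘ fmap bmonad (lam_inv S (tunit S))
      ∘ eta blax
    = thom S (eta blax) (eta blax) ∘ lam_inv S (tunit S);
  bim_counit_mult :
    epsilon boplax ∘ fmap bmonad (lam S (tunit S))
      ∘ nabla blax (tunit S) (tunit S)
    = lam S (tunit S) ∘ thom S (epsilon boplax) (epsilon boplax);
  munit_lax : lax_transformation (id_lax S) blax (munit bmonad);
  munit_oplax : oplax_transformation (id_oplax S) boplax (munit bmonad);
  mmult_lax : lax_transformation (comp_lax blax blax) blax (mmult bmonad);
  mmult_oplax : oplax_transformation (comp_oplax boplax boplax) boplax (mmult bmonad)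
}.
Arguments blax {C S} P : rename.
Arguments boplax {C S} P : rename.

Record FiniteProducts (C : Category) := {
  one : C;
  bang : forall X : C, X ~> one;
  bang_uniq : forall (X : C) (f g : X ~> one), f = g;
  prodob : C -> C -> C;
  pi1 : forall X Y : C, prodob X Y ~> X;
  pi2 : forall X Y : C, prodob X Y ~> Y;
  pairing : forall A X Y : C, (A ~> X) -> (A ~> Y) -> (A ~> prodob X Y);
  pi1_pair : forall (A X Y : C) (f : A ~> X) (g : A ~> Y), pi1 X Y ∘ pairing f g = f;
  pi2_pair : forall (A X Y : C) (f : A ~> X) (g : A ~> Y), pi2 X Y ∘ pairing f g = g;
  pair_uniq : forall (A X Y : C) (h k : A ~> prodob X Y),
    pi1 X Y ∘ h = pi1 X Y ∘ k -> pi2 X Y ∘ h = pi2 X Y ∘ k -> h = k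
}.
Arguments one {C} FP : rename.
Arguments bang {C} FP X : rename.
Arguments prodob {C} FP X Y : rename.
Arguments pi1 {C} FP X Y : rename.
Arguments pi2 {C} FP X Y : rename.
Arguments pairing {C} FP {A X Y} f g : rename.

Section Cartesian.
Variables (C : Category) (FP : FiniteProducts C).

Lemma pi1_pair_comp (A' A X Y : C) (f : A ~> X) (g : A ~> Y) (h : A' ~> A) :
  pi1 FP X Y ∘ (pairing FP f g ∘ h) = f ∘ h.
Proof. now rewrite <- comp_assoc, pi1_pair. Qed.

Lemma pi2_pair_comp (A' A X Y : C) (f : A ~> X) (g : A ~> Y) (h : A' ~> A) :
  pi2 FP X Y ∘ (pairing FP f g ∘ h) = g ∘ h.
Proof. now rewrite <- comp_assoc, pi2_pair. Qed.

End Cartesian.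

Ltac cart_simpl :=
  repeat rewrite ?comp_assoc, ?comp_idl, ?comp_idr, ?pi1_pair, ?pi2_pair,
    ?pi1_pair_comp, ?pi2_pair_comp.

Ltac cart :=
  intros; simpl; cart_simpl; try reflexivity; try apply bang_uniq;
  try (apply pair_uniq; cart).

Program Definition cartesian_monoidal (C : Category) (FP : FiniteProducts C) :
    Monoidal C :=
  {| tunit := one FP;
     tens := prodob FP;
     thom := fun X Y X' Y' f g => pairing FP (f ∘ pi1 FP X Y) (g ∘ pi2 FP X Y);
     alpha := fun X Y Z =>
       pairing FP (pi1 FP X Y ∘ pi1 FP (prodob FP X Y) Z)
         (pairing FP (pi2 FP X Y ∘ pi1 FP (prodob FP X Y) Z) (pi2 FP (prodob FP X Y) Z));
     alpha_inv := fun X Y Z =>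
       pairing FP
         (pairing FP (pi1 FP X (prodob FP Y Z)) (pi1 FP Y Z ∘ pi2 FP X (prodob FP Y Z)))
         (pi2 FP Y Z ∘ pi2 FP X (prodob FP Y Z));
     lam := fun X => pi2 FP (one FP) X;
     lam_inv := fun X => pairing FP (bang FP X) (idm X);
     rho := fun X => pi1 FP X (one FP);
     rho_inv := fun X => pairing FP (idm X) (bang FP X) |}.
Solve All Obligations with cart.

Program Definition cartesian (C : Category) (FP : FiniteProducts C) : Symmetric C :=
  {| sym_monoidal := cartesian_monoidal FP;
     braid := fun X Y => pairing FP (pi2 FP X Y) (pi1 FP X Y) |}.
Solve All Obligations with cart.

Section Prob.
Variables (C : Category) (FP : FiniteProducts C) (P : Functor C C).

Definition affine : Prop := isomorphic (P (one FP)) (one FP).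

Record ProbObj := { carrier : C; law : one FP ~> P carrier }.

Record ProbHom (A B : ProbObj) := {
  pmap : carrier A ~> carrier B;
  pmap_law : fmap P pmap ∘ law A = law B
}.

Lemma ProbHom_ext (A B : ProbObj) (f g : ProbHom A B) : pmap f = pmap g -> f = g.
Proof.
  destruct f as [f hf], g as [g hg]; simpl; intros e; subst g.
  f_equal; apply proof_irrelevance.
Qed.

Program Definition prob_id (A : ProbObj) : ProbHom A A :=
  {| pmap := idm (carrier A) |}.
Next Obligation. intros; now rewrite fmap_id, comp_idl. Qed.

Program Definition prob_comp (A B D : ProbObj) (g : ProbHom B D) (f : ProbHom A B) :
    ProbHom A D :=
  {| pmap := pmap g ∘ pmap f |}.
Next Obligation. intros; now rewrite fmap_comp, comp_assoc, !pmap_law. Qed.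

Program Definition Prob : Category :=
  {| obj := ProbObj; hom := ProbHom; idm := prob_id; comp := prob_comp |}.
Next Obligation. intros; apply ProbHom_ext, comp_idl. Qed.
Next Obligation. intros; apply ProbHom_ext, comp_idr. Qed.
Next Obligation. intros; apply ProbHom_ext, comp_assoc. Qed.

Definition push_law (A B : C) (s : one FP ~> P A) (f : A ~> B) : one FP ~> P B :=
  fmap P f ∘ s.

(** [f] as a morphism [(A, s) -> (B, Pf ∘ s)]. *)
Definition prob_map (A B : C) (s : one FP ~> P A) (f : A ~> B) :
    hom (c := Prob) {| carrier := A; law := s |}
                    {| carrier := B; law := push_law s f |} :=
  {| pmap := f : carrier {| carrier := A; law := s |}
                 ~> carrier {| carrier := B; law := push_law s f |};
     pmap_law := eq_refl |}.

Variable L : Lax (cartesian_monoidal FP) P.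
Local Notation M := (cartesian_monoidal FP).

(** [lam_inv M (one FP)] is the isomorphism [1 ≅ 1 × 1]. *)
Definition law_tens (X Y : C) (p : one FP ~> P X) (q : one FP ~> P Y) :
    one FP ~> P (prodob FP X Y) :=
  nabla L X Y ∘ thom M p q ∘ lam_inv M (one FP).

Definition prob_tens (A B : ProbObj) : ProbObj :=
  {| carrier := prodob FP (carrier A) (carrier B); law := law_tens (law A) (law B) |}.

Definition prob_unit : ProbObj := {| carrier := one FP; law := eta L |}.

Lemma law_inverse (X Y : C) (f : X ~> Y) (g : Y ~> X)
    (p : one FP ~> P X) (q : one FP ~> P Y) :
  g ∘ f = idm X -> fmap P f ∘ p = q -> fmap P g ∘ q = p.
Proof.
  now intros e <-; rewrite <- comp_assoc, <- fmap_comp, e, fmap_id, comp_idl.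
Qed.

Program Definition prob_thom (A B A' B' : ProbObj)
    (f : ProbHom A A') (g : ProbHom B B') : ProbHom (prob_tens A B) (prob_tens A' B') :=
  {| pmap := thom M (pmap f) (pmap g) : carrier (prob_tens A B) ~> carrier (prob_tens A' B') |}.
Next Obligation.
  intros; unfold prob_tens, law_tens; cbn [law carrier].
  rewrite <- (pmap_law f), <- (pmap_law g), thom_comp, <- !comp_assoc.
  now rewrite (nabla_nat L).
Qed.

Lemma alpha_law (A B D : ProbObj) :
  fmap P (alpha M (carrier A) (carrier B) (carrier D))
    ∘ law (prob_tens (prob_tens A B) D) = law (prob_tens A (prob_tens B D)).
Proof.
  unfold prob_tens, law_tens; cbn [law carrier].
  rewrite (comp_assoc (nabla L (carrier A) (carrier B))).
  rewrite (comp_assoc (nabla L (carrier B) (carrier D))).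
  rewrite thom_splitl, thom_splitr, <- !comp_assoc.
  rewrite (nabla_assoc L), !comp_assoc; do 2 f_equal.
  cart; f_equal; apply bang_uniq.
Qed.

Lemma lam_law (A : ProbObj) :
  fmap P (lam M (carrier A)) ∘ law (prob_tens prob_unit A) = law A.
Proof.
  unfold prob_tens, law_tens, prob_unit; cbn [law carrier].
  rewrite <- (comp_idr (eta L)), thom_splitl, <- !comp_assoc.
  rewrite (nabla_unit_l L); cart.
Qed.

Lemma rho_law (A : ProbObj) :
  fmap P (rho M (carrier A)) ∘ law (prob_tens A prob_unit) = law A.
Proof.
  unfold prob_tens, law_tens, prob_unit; cbn [law carrier].
  rewrite <- (comp_idr (eta L)), thom_splitr, <- !comp_assoc.
  rewrite (nabla_unit_r L); cart.
  now rewrite (bang_uniq (bang FP (one FP)) (idm _)), comp_idr.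
Qed.

Lemma alpha_inv_law (A B D : ProbObj) :
  fmap P (alpha_inv M (carrier A) (carrier B) (carrier D))
    ∘ law (prob_tens A (prob_tens B D)) = law (prob_tens (prob_tens A B) D).
Proof. eapply law_inverse; [apply (alphaK M) | apply alpha_law]. Qed.

Lemma lam_inv_law (A : ProbObj) :
  fmap P (lam_inv M (carrier A)) ∘ law A = law (prob_tens prob_unit A).
Proof. eapply law_inverse; [apply (lamK M) | apply lam_law]. Qed.

Lemma rho_inv_law (A : ProbObj) :
  fmap P (rho_inv M (carrier A)) ∘ law A = law (prob_tens A prob_unit).
Proof. eapply law_inverse; [apply (rhoK M) | apply rho_law]. Qed.

Program Definition Prob_monoidal : Monoidal Prob :=
  {| tunit := prob_unit : Prob;
     tens := prob_tens;
     thom := prob_thom;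
     alpha := fun A B D =>
       {| pmap := alpha M (carrier A) (carrier B) (carrier D);
          pmap_law := alpha_law A B D |};
     alpha_inv := fun A B D =>
       {| pmap := alpha_inv M (carrier A) (carrier B) (carrier D);
          pmap_law := alpha_inv_law A B D |};
     lam := fun A => {| pmap := lam M (carrier A); pmap_law := lam_law A |};
     lam_inv := fun A =>
       {| pmap := lam_inv M (carrier A);
          pmap_law := lam_inv_law A |};
     rho := fun A => {| pmap := rho M (carrier A); pmap_law := rho_law A |};
     rho_inv := fun A =>
       {| pmap := rho_inv M (carrier A);
          pmap_law := rho_inv_law A |} |}.
Next Obligation. intros; apply ProbHom_ext, (thom_id M). Qed.
Next Obligation. intros; apply ProbHom_ext, (thom_comp M). Qed.
Next Obligation. intros; apply ProbHom_ext, (alpha_nat M). Qed.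
Next Obligation. intros; apply ProbHom_ext, (lam_nat M). Qed.
Next Obligation. intros; apply ProbHom_ext, (rho_nat M). Qed.
Next Obligation. intros; apply ProbHom_ext, (alphaK M). Qed.
Next Obligation. intros; apply ProbHom_ext, (alpha_invK M). Qed.
Next Obligation. intros; apply ProbHom_ext, (lamK M). Qed.
Next Obligation. intros; apply ProbHom_ext, (lam_invK M). Qed.
Next Obligation. intros; apply ProbHom_ext, (rhoK M). Qed.
Next Obligation. intros; apply ProbHom_ext, (rho_invK M). Qed.
Next Obligation. intros; apply ProbHom_ext, (pentagon M). Qed.
Next Obligation. intros; apply ProbHom_ext, (triangle M). Qed.

Hypothesis aff : affine.

Lemma affine_law_uniq (p q : one FP ~> P (one FP)) : p = q.
Proof.
  destruct aff as [f [g [gf _]]].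
  rewrite <- (comp_idl p), <- (comp_idl q), <- gf, !comp_assoc.
  f_equal; apply bang_uniq.
Qed.

Definition prob_discard (A : ProbObj) : ProbHom A prob_unit :=
  {| pmap := bang FP (carrier A) : carrier A ~> carrier prob_unit;
     pmap_law := affine_law_uniq _ _ |}.

Program Definition Prob_semicartesian : Semicartesian Prob :=
  {| semi_monoidal := Prob_monoidal; discard := prob_discard |}.
Next Obligation. intros; apply ProbHom_ext, bang_uniq. Qed.

(** Consistency check: the projections [A ⊗ B -> A ⊗ I -> A] built from discarding
    agree with the product projections. *)
Lemma pmap_tproj1 (A B : ProbObj) :
  pmap (tproj1 Prob_semicartesian A B) = pi1 FP (carrier A) (carrier B).
Proof. cart. Qed.

Lemma pmap_tproj2 (A B : ProbObj) :
  pmap (tproj2 Prob_semicartesian A B) = pi2 FP (carrier A) (carrier B).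
Proof. cart. Qed.

End Prob.

(* Main.v *)
(** The counit laws and naturality force [Δ = (Pπ1, Pπ2)], so that
    [Δ ∘ P(f1,f2) ∘ s = (r1, r2)] and the left-hand side of the equation is
    [r1 ⊗_∇ r2].  A Franz witness can only be [(f1,f2)], and it is a witness iff it
    sends [s] to [r1 ⊗_∇ r2]. *)
Require Import Defs.
Local Open Scope cat_scope.

Section OplaxCartesian.
Variables (C : Category) (FP : FiniteProducts C) (F : Functor C C).
Variable O : Oplax (cartesian_monoidal FP) F.
Local Notation M := (cartesian_monoidal FP).

(* Naturality in [Y -> 1] reduces the claim to [Y = 1], which is the counit law. *)
Lemma pi1_Delta (X Y : C) :
  pi1 FP (F X) (F Y) ∘ Delta O X Y = fmap F (pi1 FP X Y).
Proof.
  assert (N := f_equal (comp (pi1 FP (F X) (F (one FP))))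
                 (Delta_nat O (idm X) (bang FP Y))).
  assert (U := Delta_unit_r O X).
  simpl in N, U; rewrite pi1_pair, ?comp_idl in U.
  rewrite <- !comp_assoc, pi1_pair, fmap_id, !comp_idl in N.
  simpl; now rewrite <- N, U, <- fmap_comp, pi1_pair.
Qed.

Lemma pi2_Delta (X Y : C) :
  pi2 FP (F X) (F Y) ∘ Delta O X Y = fmap F (pi2 FP X Y).
Proof.
  assert (N := f_equal (comp (pi2 FP (F (one FP)) (F Y)))
                 (Delta_nat O (bang FP X) (idm Y))).
  assert (U := Delta_unit_l O Y).
  simpl in N, U; rewrite pi2_pair, ?comp_idl in U.
  rewrite <- !comp_assoc, pi2_pair, fmap_id, !comp_idl in N.
  simpl; now rewrite <- N, U, <- fmap_comp, pi2_pair.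
Qed.

(** Checked on the two projections, where the previous lemmas leave only functoriality of [F]. *)
Lemma Delta_pairing (A X Y : C) (f : A ~> X) (g : A ~> Y) :
  Delta O X Y ∘ fmap F (pairing FP f g) = pairing FP (fmap F f) (fmap F g).
Proof.
  apply pair_uniq; rewrite <- comp_assoc.
  - now rewrite pi1_Delta, <- fmap_comp, !pi1_pair.
  - now rewrite pi2_Delta, <- fmap_comp, !pi2_pair.
Qed.

(** Identifies the left side of the independence equation with the product of the marginals: both
    apply [nabla] to the pair of pushed laws. *)
Lemma law_tens_push (L : Lax M F) (A X Y : C) (s : one FP ~> F A)
    (f : A ~> X) (g : A ~> Y) :
  law_tens L (push_law s f) (push_law s g)
  = nabla L X Y ∘ Delta O X Y ∘ fmap F (pairing FP f g) ∘ s.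
Proof.
  unfold law_tens, push_law.
  rewrite (comp_assoc (nabla L X Y) (Delta O X Y)), Delta_pairing, !comp_assoc.
  f_equal; apply pair_uniq; cart_simpl; simpl; cart_simpl.
  (* The first component of [lam_inv] at [1] is [bang], equal to the identity because [1] is
     terminal. *)
  - now rewrite (bang_uniq (bang FP (one FP)) (idm _)), comp_idr.
  - reflexivity.
Qed.

End OplaxCartesian.

Theorem proposition4p4 (C : Category) (FP : FiniteProducts C)
    (P : BimonoidalMonad (cartesian FP)) (aff : affine FP P)
    (A B1 B2 : C) (s : one FP ~> P A) (f1 : A ~> B1) (f2 : A ~> B2) :
  franz_independent (Prob_semicartesian (blax P) aff)
    (prob_map s f1) (prob_map s f2)
  <->
  nabla (blax P) B1 B2 ∘ Delta (boplax P) B1 B2 ∘ fmap P (pairing FP f1 f2) ∘ s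
  = fmap P (pairing FP f1 f2) ∘ s.
Proof.
  rewrite <- (law_tens_push _ _ _ (boplax P) (blax P)).
  split.
  - intros [h [h1 h2]].
    apply (f_equal (fun k => pmap k)) in h1, h2.
    (* Composition in [Prob] unfolds to composition of underlying maps. *)
    change (pmap (tproj1 (Prob_semicartesian (blax P) aff) _ _) ∘ pmap h = f1) in h1.
    change (pmap (tproj2 (Prob_semicartesian (blax P) aff) _ _) ∘ pmap h = f2) in h2.
    rewrite pmap_tproj1 in h1; rewrite pmap_tproj2 in h2.
    assert (e : pairing FP f1 f2 = pmap h).
    { apply pair_uniq; [now rewrite pi1_pair | now rewrite pi2_pair]. }
    rewrite e; symmetry; exact (pmap_law h).
  - intros e.
    pose (X0 := {| carrier := A; law := s |}).
    pose (X1 := {| carrier := B1; law := push_law s f1 |}).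
    pose (X2 := {| carrier := B2; law := push_law s f2 |}).
    (* The equation [e], reversed, is exactly the law condition making the pairing a morphism into
       the tensor. *)
    exists (@Build_ProbHom _ _ _ X0 (prob_tens (blax P) X1 X2)
              (pairing FP f1 f2) (eq_sym e)).
    split; apply ProbHom_ext.
    + cbn [comp Prob prob_comp pmap]. rewrite pmap_tproj1. apply pi1_pair.
    + cbn [comp Prob prob_comp pmap]. rewrite pmap_tproj2. apply pi2_pair.
Qed.
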